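(* Let $(\varphi,\psi)$ be a pair of kernels with $M_0(\psi)<+\infty$, let $\eta$ be a convex $\varphi$-function, and let $f\in L^\eta(\mathbb{R})$ be fixed. Then there exists $\lambda>0$ such that $$I^\eta[\lambda S_w^{\varphi,\psi}f]\le\frac{M_0(\psi)\,\lVert\varphi\rVert_1}{M_0(\varphi)\,\tilde M_0(\psi)}\,I^\eta[\lambda M_0(\varphi)\tilde M_0(\psi)f]\qquad\text{for every } w>0.$$ In particular, $S_w^{\varphi,\psi}f$ is well-defined and belongs to $L^\eta(\mathbb{R})$ for every $w>0$.
   Context: For $g:\mathbb{R}\to\mathbb{R}$ and $\nu\ge 0$ put $$M_\nu(g):=\sup_{u\in\mathbb{R}}\sum_{k\in\mathbb{Z}}|g(u-k)|\,|u-k|^\nu,\qquad \tilde M_\nu(g):=\int_{\mathbb{R}}|t|^\nu|g(t)|\,dt,$$ so that $M_0(g)=\sup_{u}\sum_{k}|g(u-k)|$ and $\tilde M_0(g)=\lVert g\rVert_1$. A pair of kernels $(\varphi,\psi)$ is a pair of functions $\varphi,\psi:\mathbb{R}\to\mathbb{R}$ in $L^1(\mathbb{R})$ such that: $\varphi$ is bounded in a neighborhood of the origin; $\sum_{k\in\mathbb{Z}}\varphi(u-k)=1$ for every $u\in\mathbb{R}$; $\int_{\mathbb{R}}\psi(u)\,du=1$; and there exists $r>0$ with $M_r(\varphi)<+\infty$. (Under these assumptions $M_0(\varphi)<+\infty$.) The Durrmeyer sampling operators are, for $w>0$ and any $f$ for which the series converges for every $x$, $$(S_w^{\varphi,\psi}f)(x)=\sum_{k\in\mathbb{Z}}\varphi(wx-k)\,w\int_{\mathbb{R}}\psi(wu-k)f(u)\,du,\qquad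 x\in\mathbb{R}.$$ A convex $\varphi$-function (standard terminology, unrelated to the kernel $\varphi$) is a convex function $\eta:[0,\infty)\to[0,\infty)$ with $\eta(0)=0$ and $\eta(u)>0$ for every $u>0$. For $f\in M(\mathbb{R})$, the space of Lebesgue measurable real functions on $\mathbb{R}$, put $I^\eta[f]:=\int_{\mathbb{R}}\eta(|f(x)|)\,dx$. The Orlicz space is $L^\eta(\mathbb{R})=\{f\in M(\mathbb{R}): I^\eta[\lambda f]<+\infty\text{ for some }\lambda>0\}$. *)

(* Defs.v *)
From HB Require Import structures.
From mathcomp Require Import all_boot all_order all_algebra.
From mathcomp Require Import all_classical all_reals all_analysis.

Set Implicit Arguments.
Unset Strict Implicit.
Unset Printing Implicit Defensive.
Import Order.TTheory GRing.Theory Num.Theory.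
Import numFieldNormedType.Exports.

Local Open Scope classical_set_scope.
Local Open Scope ring_scope.

(* The real line with the sigma-algebra of Lebesgue measurable sets, that is,
   the domain of [completed_lebesgue_measure]; the default measurable structure
   on [R] is the Borel one. *)
Notation lebesgueR R := (caratheodory_type (@wlength R idfun)^*%mu).

Notation leb := completed_lebesgue_measure.

(* The codomain [R] carries the Borel sigma-algebra. *)
Definition lebesgue_measurable (R : realType) (f : R -> R) : Prop :=
  measurable_fun [set: lebesgueR R] (f : lebesgueR R -> R).

Definition in_L1 (R : realType) (f : R -> R) : Prop :=
  leb.-integrable [set: lebesgueR R] (EFin \o f).

(* Two-sided series: it converges when the series over k >= 0 and the series
   over k < 0 both do; [Negz n] is -(n+1). *)
Definition cvg_sumZ (R : realType) (a : int -> R) : Prop :=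
  cvgn (series (fun n : nat => a (Posz n))) /\
  cvgn (series (fun n : nat => a (Negz n))).

Definition sumZ (R : realType) (a : int -> R) : R :=
  limn (series (fun n : nat => a (Posz n))) +
  limn (series (fun n : nat => a (Negz n))).

(* The convention 0 `^ 0 = 1 makes [dmoment 0 g] the supremum of the sums of
   the |g(u - k)|, including the term u = k. *)
Definition dmoment (R : realType) (nu : R) (g : R -> R) : \bar R :=
  ereal_sup [set (\esum_(k in [set: int])
    (`|g (u - k%:~R)| * `|u - k%:~R| `^ nu)%:E)%E | u in [set: R]].

Definition cmoment (R : realType) (nu : R) (g : R -> R) : \bar R :=
  (\int[leb]_(t in [set: lebesgueR R]) (`|t : R| `^ nu * `|g t|)%:E)%E.

Record kernel_pair (R : realType) (phi psi : R -> R) : Prop := KernelPair {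
  kernel_phi_L1 : in_L1 phi;
  kernel_psi_L1 : in_L1 psi;
  kernel_phi_bounded : bounded_near phi (nbhs (0 : R));
  kernel_phi_cvg : forall u, cvg_sumZ (fun k => phi (u - k%:~R));
  kernel_phi_sum : forall u, sumZ (fun k => phi (u - k%:~R)) = 1;
  kernel_psi_int : \int[leb]_(u in [set: lebesgueR R]) psi u = 1;
  kernel_phi_moment : exists2 r : R, 0 < r & (dmoment r phi < +oo)%E }.

Definition durrmeyer_term (R : realType) (phi psi : R -> R) (w : R)
    (f : R -> R) (x : R) (k : int) : R :=
  phi (w * x - k%:~R) *
  (w * \int[leb]_(u in [set: lebesgueR R]) (psi (w * (u : R) - k%:~R) * f u)).

Definition durrmeyer (R : realType) (phi psi : R -> R) (w : R)
    (f : R -> R) (x : R) : R :=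
  sumZ (durrmeyer_term phi psi w f x).

Definition durrmeyer_defined (R : realType) (phi psi : R -> R) (w : R)
    (f : R -> R) : Prop :=
  (forall k : int, in_L1 (fun u => psi (w * u - k%:~R) * f u)) /\
  (forall x, cvg_sumZ (durrmeyer_term phi psi w f x)).

(* Only the values of [eta] on the half-line [0, +oo[ are relevant; that they
   are nonnegative follows from the first two fields. *)
Record convex_phi_function (R : realType) (eta : R -> R) : Prop :=
  ConvexPhiFunction {
    cphi_at0 : eta 0 = 0;
    cphi_gt0 : forall u, 0 < u -> 0 < eta u;
    cphi_convex : convex_function `[(0 : R), +oo[%classic (eta : R^o -> R^o) }.

Definition modular (R : realType) (eta f : R -> R) : \bar R :=
  (\int[leb]_(x in [set: lebesgueR R]) (eta `|f x|)%:E)%E.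

Definition in_orlicz (R : realType) (eta f : R -> R) : Prop :=
  lebesgue_measurable f /\
  exists2 lambda : R,
    0 < lambda & (modular eta (fun x => (lambda * f x)%R) < +oo)%E.

(* Main.v *)
Require Import Defs.
From mathcomp Require Import all_boot all_order all_algebra.
From mathcomp Require Import all_classical all_reals all_analysis.
From mathcomp Require Import measurable_realfun zify ring lra.
Import Order.TTheory GRing.Theory Num.Theory.
Import numFieldNormedType.Exports.
Local Open Scope classical_set_scope.
Local Open Scope ring_scope.

(** Write [M], [N] for the discrete moment [M_0] of [phi] and the L^1 norm of
    [psi]. For fixed [x], the sum
      [h |-> sum_k |phi (w x - k)| * int w |psi (w u - k)| h(u) du]
    is a positive linear functional of mass at most [M * N] ([mixture],
    [mixture_mass]) that dominates [|S_w f (x)|] at [h = |f|] ([durrmeyer_cvg]).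
    A single application of Jensen's inequality to this functional
    ([mixture_jensen]) therefore gives, for every [l >= 0],
      [M N eta(l |S_w f (x)|)
         <= sum_k |phi (w x - k)| * int w |psi (w u - k)| eta(l M N |f(u)|) du].
    Integrating in [x], each [|phi (w x - k)|] contributes [||phi||_1 / w], and
    the remaining sum of the [w |psi (w u - k)|] over [k] is at most [w] times
    the discrete moment of [psi]; the factors [w] cancel ([modular_durrmeyer]).
    It remains to choose [l] so that the modular of [l M N f] is finite.

    That [S_w f] makes sense is due to the growth of [eta], which is at least
    linear ([cphi_ge_linear]): on the set where [l |f| <= 1] the function [f]
    is bounded, and elsewhere
    [l |f| <= eta(l |f|) / eta 1], so that [f] is the sum of a bounded and of
    an integrable function. As [psi] is both integrable and bounded (by its
    discrete moment), the integrals of [|psi (w u - k) f(u)|] are bounded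
    uniformly in [k] ([window_integral_bound]), and the series converges
    absolutely because [M] is finite ([dmoment0_lty]).

    The substitutions [u |-> w u - k] take place in the Lebesgue sigma-algebra,
    which is defined through the Caratheodory criterion; they are justified by
    the behaviour of the Lebesgue outer measure under affine maps
    ([outer_affine]). *)

Set Implicit Arguments.
Unset Strict Implicit.
Unset Printing Implicit Defensive.

(** * Affine changes of variables for the completed Lebesgue measure *)

Definition affine (R : realType) (a b x : R) : R := a * x + b.

Lemma preimage_affine_ocitv (R : realType) (a b : R) (A : set (ocitv_type R)) :
  0 < a -> ocitv A -> ocitv (affine a b @^-1` A) /\
  wlength idfun A = (a%:E * wlength idfun (affine a b @^-1` A))%E.
Proof.
move=> a0 [[l r] _ <-] /=.
have -> : affine a b @^-1` `]l, r] = `](l - b) / a, (r - b) / a]%classic.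
  apply/seteqP; split=> x; rewrite /affine /= !in_itv/= ltr_pdivrMr// ler_pdivlMr//.
    by rewrite ltrBlDr lerBrDr mulrC.
  by rewrite ltrBlDr lerBrDr mulrC.
split; first exact: is_ocitv.
have [lr|rl] := ltP l r.
  rewrite !wlength_itv_bnd ?(ltW lr)//.
    by rewrite -EFinM /=; congr EFin; field; rewrite gt_eqF.
  by rewrite ler_pM2r ?invr_gt0// lerD2r ltW.
rewrite !set_itv_ge ?bnd_simp -?leNgt ?wlength0 ?mule0//.
by rewrite ler_pM2r ?invr_gt0// lerD2r.
Qed.

Local Notation outer R := ((@wlength R idfun)^*%mu).

(** The map [x |-> x / a - b / a] is the inverse of [affine a b]. *)
Lemma affineK (R : realType) (a b : R) (A : set R) : 0 < a ->
  affine a^-1 (- b / a) @^-1` (affine a b @^-1` A) = A.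
Proof.
move=> a0; rewrite -comp_preimage (_ : _ \o _ = id)//.
by apply/funext => x; rewrite /affine/=; field; rewrite gt_eqF.
Qed.

(** The preimages of the half-open intervals that cover [A] cover the preimage
    of [A], and their lengths are those of the original ones divided by [a]. *)
Lemma outer_affine_le (R : realType) (a b : R) (A : set R) : 0 < a ->
  (a%:E * outer R (affine a b @^-1` A) <= outer R A)%E.
Proof.
move=> a0; apply: le_ereal_inf_tmp => _ [B [mB AB] <-].
have hB k := preimage_affine_ocitv b a0 (mB k).
under eq_eseriesr do rewrite (hB _).2.
rewrite nneseriesZl; last by move=> k _; exact: wlength_ge0.
rewrite lee_pmul2l// ?lte_fin//; apply: ereal_inf_lbound.
exists (fun k => affine a b @^-1` (B k)) => //; split.
  by move=> k; exact: (hB k).1.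
by rewrite -preimage_bigcup; exact: preimage_subset.
Qed.

(** The converse inequality is [outer_affine_le] for the inverse map. *)
Lemma outer_affine (R : realType) (a b : R) (A : set R) : 0 < a ->
  (outer R (affine a b @^-1` A) = a^-1%:E * outer R A)%E.
Proof.
move=> a0; have ai0 : 0 < a^-1 by rewrite invr_gt0.
apply/eqP; rewrite eq_le; apply/andP; split.
  rewrite -(@lee_pmul2l _ a%:E)// ?lte_fin// muleA -EFinM divff ?gt_eqF//.
  by rewrite mul1e outer_affine_le.
rewrite -[in leLHS](affineK b A a0); exact: outer_affine_le.
Qed.

(** Every test set of the Caratheodory criterion is the preimage of a test set,
    so the criterion for [A], scaled by [a^-1], is that for its preimage. *)
Lemma measurable_affine (R : realType) (a b : R) : 0 < a ->
  measurable_fun [set: lebesgueR R] (affine a b : lebesgueR R -> lebesgueR R).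
Proof.
move=> a0 _ A mA; rewrite setTI.
have {}mA : (outer R).-caratheodory A by exact: mA.
suff : (outer R).-caratheodory (affine a b @^-1` A) by [].
move=> X.
have ai0 : 0 < a^-1 by rewrite invr_gt0.
have [Y ->] : exists Y, X = affine a b @^-1` Y.
  exists (affine a^-1 (- b / a) @^-1` X).
  have := affineK (- b / a) X ai0.
  have -> : - (- b / a) / a^-1 = b by field; rewrite gt_eqF.
  by rewrite invrK => ->.
transitivity (a^-1%:E * (outer R (Y `&` A) + outer R (Y `&` ~` A)))%E.
  by rewrite (outer_affine b Y a0); congr (_ * _)%E; exact: mA.
rewrite ge0_muleDr; [|exact: outer_measure_ge0..].
congr (_ + _)%E; first exact/esym/(outer_affine b (Y `&` A) a0).
exact/esym/(outer_affine b (Y `&` ~` A) a0).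
Qed.

Lemma ge0_integral_affine (R : realType) (a b : R) (g : R -> \bar R) :
  0 < a -> measurable_fun [set: lebesgueR R] g ->
  (forall x, 0 <= g x)%E ->
  (\int[leb]_(x in [set: lebesgueR R]) g (affine a b x) =
   a^-1%:E * \int[leb]_(x in [set: lebesgueR R]) g x)%E.
Proof.
move=> a0 mg g0; have ai0 : 0 <= a^-1 by rewrite invr_ge0 ltW.
have mT := measurable_affine b a0.
rewrite -(@ge0_integral_mscale _ _ _ leb _ measurableT (NngNum ai0))//.
pose T : lebesgueR R -> lebesgueR R := affine a b.
transitivity (\int[pushforward leb T]_(y in [set: lebesgueR R]) g y)%E.
  by rewrite ge0_integral_pushforward.
apply: eq_measure_integral => A mA _; exact: outer_affine.
Qed.
(** * Series indexed by the integers *)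

Section IntegerSeries.
Context {R : realType}.
Local Open Scope ereal_scope.
Implicit Types a : int -> \bar R.

Lemma esum_int a : (forall k, 0 <= a k) ->
  \esum_(k in [set: int]) a k =
  \sum_(n <oo) a (Posz n) + \sum_(n <oo) a (Negz n).
Proof.
move=> a0; rewrite (esumID (range Posz))// !setTI.
have -> : ~` range Posz = range Negz.
  apply/seteqP; split=> [[n h|n _]|_ [n _ <-] []//].
    by case: h; exists n.
  by exists n.
rewrite !nneseries_esumT//; congr (_ + _); apply: reindex_esum.
  by split=> [n _|m n _ _ [//]|_ [n _ <-]]; exists n.
by split=> [n _|m n _ _ [//]|_ [n _ <-]]; exists n.
Qed.

Lemma esum_intZl a (c : R) : (forall k, 0 <= a k) -> (0 <= c)%R ->
  \esum_(k in [set: int]) (c%:E * a k) = c%:E * \esum_(k in [set: int]) a k.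
Proof.
move=> a0 c0; rewrite !esum_int//; last by move=> k; rewrite mule_ge0.
by rewrite !nneseriesZl// ge0_muleDr// nneseries_ge0.
Qed.

Context d (T : measurableType d) (mu : {measure set T -> \bar R}).
Implicit Types f : int -> T -> \bar R.

Lemma measurable_esum_int f :
  (forall k, measurable_fun setT (f k)) -> (forall k x, 0 <= f k x) ->
  measurable_fun setT (fun x => \esum_(k in [set: int]) f k x).
Proof.
move=> mf f0; under eq_fun do rewrite esum_int//.
by apply: emeasurable_funD; apply: ge0_emeasurable_sum.
Qed.

Lemma integral_esum_int f :
  (forall k, measurable_fun setT (f k)) -> (forall k x, 0 <= f k x) ->
  \int[mu]_x (\esum_(k in [set: int]) f k x) =
  \esum_(k in [set: int]) \int[mu]_x f k x.
Proof.
move=> mf f0; rewrite esum_int; last by move=> k; exact: integral_ge0.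
under eq_integral do rewrite esum_int//.
rewrite ge0_integralD//.
- by rewrite !integral_nneseries.
- by move=> x _; exact: nneseries_ge0.
- exact: ge0_emeasurable_sum.
- by move=> x _; exact: nneseries_ge0.
- exact: ge0_emeasurable_sum.
Qed.

Lemma normed_cvg_nneseries (a : nat -> R) : \sum_(n <oo) `|a n|%:E < +oo ->
  cvgn (series a) /\ `|limn (series a)|%:E <= \sum_(n <oo) `|a n|%:E.
Proof.
move=> aoo.
have sa : summable xpredT (fun n => `|a n|%:E).
  rewrite /summable; apply: le_lt_trans aoo; rewrite nneseries_esum//.
  by apply: le_esum => n _ /=; rewrite normr_id.
have ca : cvgn [normed series a] by exact: (summable_cvg _ sa).
split; first exact: normed_cvg.
rewrite (summable_nneseries_lim _ sa)// lee_fin; exact: lim_series_norm.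
Qed.

Lemma normed_cvg_sumZ (a : int -> R) :
  \esum_(k in [set: int]) `|a k|%:E < +oo ->
  cvg_sumZ a /\ `|sumZ a|%:E <= \esum_(k in [set: int]) `|a k|%:E.
Proof.
move=> aoo; have a0 k : 0 <= `|a k|%:E by rewrite lee_fin.
have s0 (g : nat -> int) : 0 <= \sum_(n <oo) `|a (g n)|%:E by exact: nneseries_ge0.
move: aoo; rewrite esum_int// => aoo.
have [cp lp] := normed_cvg_nneseries (le_lt_trans (leeDl _ (s0 Negz)) aoo).
have [cn ln] := normed_cvg_nneseries (le_lt_trans (leeDr _ (s0 Posz)) aoo).
split; first by split.
by apply: le_trans (leeD lp ln); rewrite -EFinD lee_fin ler_normD.
Qed.

Lemma measurable_sumZ (f : int -> T -> R) :
  (forall k, measurable_fun setT (f k)) ->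
  (forall x, cvg_sumZ (f ^~ x)) -> measurable_fun setT (fun x => sumZ (f ^~ x)).
Proof.
move=> mf cf; apply: measurable_funD.
- apply: (measurable_fun_cvg (h := fun n x => series (fun k => f (Posz k) x) n)).
    by move=> n; exact: measurable_sum.
  by move=> x _; exact: (cf x).1.
- apply: (measurable_fun_cvg (h := fun n x => series (fun k => f (Negz k) x) n)).
    by move=> n; exact: measurable_sum.
  by move=> x _; exact: (cf x).2.
Qed.

End IntegerSeries.
(** * Convex phi-functions *)

Section ConvexPhi.
Context {R : realType} (eta : R -> R).
Hypothesis heta : convex_phi_function eta.

Lemma cphi_ge0 u : 0 <= u -> 0 <= eta u.
Proof.
rewrite le_eqVlt => /predU1P[<-|u0]; first by rewrite (cphi_at0 heta).
exact/ltW/(cphi_gt0 heta).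
Qed.

Lemma cphi_convexE p x y : 0 <= p <= 1 -> 0 <= x -> 0 <= y ->
  eta (p * x + (1 - p) * y) <= p * eta x + (1 - p) * eta y.
Proof.
move=> /andP[p0 p1] x0 y0.
have [t ->] : exists t : {i01 R}, p = t%:num.
  by exists (Itv01 p0 p1).
have := cphi_convex heta t (x := x) (y := y).
by rewrite !inE/= !in_itv/= !andbT => /(_ x0 y0).
Qed.

(** The value at [y] lies below the chord from [x] to [z]; clearing the
    denominators leaves to linear arithmetic the comparison of slopes. *)
Lemma cphi_three_points x y z : 0 <= x -> x < y -> y < z ->
  (z - x) * eta y <= (z - y) * eta x + (y - x) * eta z.
Proof.
move=> x0 xy yz.
have zx : 0 < z - x by rewrite subr_gt0 (lt_trans xy).
have zx0 : z - x != 0 by rewrite gt_eqF.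
have p01 : 0 <= (z - y) / (z - x) <= 1.
  by rewrite divr_ge0 ?ler_pdivrMr ?mul1r//; lra.
have := cphi_convexE p01 x0 (ltW (le_lt_trans x0 (lt_trans xy yz))).
have -> : (z - y) / (z - x) * x + (1 - (z - y) / (z - x)) * z = y by field.
rewrite -(ler_pM2l zx) => /le_trans; apply.
by rewrite le_eqVlt; apply/orP; left; apply/eqP; field.
Qed.

Lemma cphi_nondecreasing x y : 0 <= x -> x <= y -> eta x <= eta y.
Proof.
rewrite le_eqVlt => /predU1P[<- y0|x0].
  by rewrite (cphi_at0 heta) cphi_ge0.
rewrite le_eqVlt => /predU1P[->//|xy].
have := cphi_three_points (lexx 0) x0 xy.
rewrite (cphi_at0 heta) mulr0 add0r !subr0 => h.
have y0 := lt_trans x0 xy.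
rewrite -(ler_pM2l y0) (le_trans h)// ler_wpM2r// ?ltW//.
exact: cphi_gt0.
Qed.

Lemma cphi_ge_linear u : 1 <= u -> eta 1 * u <= eta u.
Proof.
rewrite le_eqVlt => /predU1P[<-|u1]; first by rewrite mulr1.
have := cphi_three_points (lexx 0) ltr01 u1.
by rewrite (cphi_at0 heta) mulr0 add0r !subr0 mul1r mulrC.
Qed.

(** The line [t |-> s * t - c] touches the graph of [eta] at [y] and stays below
    it. Taking for [s] the supremum of the slopes of the chords that end at
    [y], rather than the slope on the right, gives both signs at once: the
    chord that starts at the origin has slope [eta y / y], whence [0 <= s] and
    [0 <= c]. Writing the inequality as [s * t <= eta t + c] keeps all terms
    nonnegative, hence usable under extended real integrals. *)
Lemma cphi_tangent y : 0 <= y -> exists s c : R,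
  [/\ 0 <= s, 0 <= c, s * y = eta y + c & forall t, 0 <= t -> s * t <= eta t + c].
Proof.
rewrite le_eqVlt => /predU1P[<-|y0].
  exists 0, 0; split=> //; first by rewrite mul0r (cphi_at0 heta) addr0.
  by move=> t t0; rewrite mul0r addr0 cphi_ge0.
pose S := [set (eta y - eta x) / (y - x) | x in [set x | 0 <= x < y]].
have S0 : S (eta y / y).
  by exists 0; rewrite /= ?lexx//= (cphi_at0 heta) !subr0.
have ubS z : y < z -> ubound S ((eta z - eta y) / (z - y)).
  move=> yz _ [x /= /andP[x0 xy] <-].
  have yx : 0 < y - x by rewrite subr_gt0.
  have zy : 0 < z - y by rewrite subr_gt0.
  rewrite ler_pdivrMr// mulrAC ler_pdivlMr//.
  by have := cphi_three_points x0 xy yz; lra.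
have hS : has_sup S.
  split; first by exists (eta y / y).
  by exists ((eta (y + 1) - eta y) / (y + 1 - y)); apply: ubS; lra.
exists (sup S), (sup S * y - eta y).
have sS : eta y / y <= sup S by apply: ub_le_sup; [exact: hS.2|].
split.
- by rewrite (le_trans _ sS)// divr_ge0// ?cphi_ge0// ltW.
- by rewrite subr_ge0 -ler_pdivrMr.
- by rewrite addrCA subrr addr0.
- move=> t t0; have [ty|yt|->] := ltgtP t y; last by rewrite addrCA subrr addr0.
  + have : (eta y - eta t) / (y - t) <= sup S.
      by apply: ub_le_sup; [exact: hS.2|]; exists t => //=; rewrite t0.
    by rewrite ler_pdivrMr ?subr_gt0//; lra.
  + have : sup S <= (eta t - eta y) / (t - y).
      by apply: ge_sup; [exists (eta y / y)|exact: ubS].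
    by rewrite ler_pdivlMr ?subr_gt0//; lra.
Qed.

Lemma measurable_cphi_norm d (T : measurableType d) (g : T -> R) :
  measurable_fun setT g -> measurable_fun setT (fun x => eta `|g x|).
Proof.
move=> mg.
(* [eta] is arbitrary on the negative half-line, hence the truncation *)
have -> : (fun x => eta `|g x|) =
    (fun t => eta (Num.max 0 t)) \o (fun x => `|g x|).
  by apply/funext => x /=; rewrite max_r.
apply: measurableT_comp; last exact: measurableT_comp.
apply: nondecreasing_measurable => // x y xy.
apply: cphi_nondecreasing; first by rewrite le_max lexx.
by rewrite ge_max le_max lexx/= le_max xy orbT.
Qed.

End ConvexPhi.
(** * Jensen's inequality for mixtures *)

Section Mixture.
Context {R : realType} d (T : measurableType d) (mu : {measure set T -> \bar R}).
Local Open Scope ereal_scope.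
Variables (P : int -> R) (Q : int -> T -> R).
Hypothesis P0 : forall k, (0 <= P k)%R.
Hypothesis Q0 : forall k u, (0 <= Q k u)%R.
Hypothesis mQ : forall k, measurable_fun setT (Q k).
Implicit Types h : T -> R.

(** The integral of [h] against the measure whose density is the sum of the
    [P k * Q k]. *)
Definition mixture h : \bar R :=
  \esum_(k in [set: int]) ((P k)%:E * \int[mu]_u (Q k u * h u)%:E).

Let mQh k h : measurable_fun setT h ->
  measurable_fun setT (fun u => (Q k u * h u)%:E).
Proof. by move=> mh; apply/measurable_EFinP; exact: measurable_funM. Qed.

Let Qh0 k h : (forall u, 0 <= h u)%R -> forall u, 0 <= (Q k u * h u)%:E.
Proof. by move=> h0 u; rewrite lee_fin mulr_ge0. Qed.

Lemma mixtureZ (c : R) h :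
  (0 <= c)%R -> measurable_fun setT h -> (forall u, 0 <= h u)%R ->
  mixture (fun u => c * h u)%R = c%:E * mixture h.
Proof.
move=> c0 mh h0; rewrite /mixture -esum_intZl//; last first.
  by move=> k; rewrite mule_ge0 ?lee_fin// integral_ge0// => u _; exact: Qh0.
apply: eq_esum => k _; rewrite muleCA; congr (_ * _).
rewrite -ge0_integralZl//; last by move=> u _; exact: Qh0.
  by apply: eq_integral => u _; rewrite -EFinM mulrCA.
exact: mQh.
Qed.

Lemma mixtureD h1 h2 : measurable_fun setT h1 -> (forall u, 0 <= h1 u)%R ->
  measurable_fun setT h2 -> (forall u, 0 <= h2 u)%R ->
  mixture (h1 \+ h2)%R = mixture h1 + mixture h2.
Proof.
move=> m1 h10 m2 h20; rewrite /mixture -esumD; last 2 first.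
- by move=> k _; rewrite mule_ge0 ?lee_fin// integral_ge0// => u _; exact: Qh0.
- by move=> k _; rewrite mule_ge0 ?lee_fin// integral_ge0// => u _; exact: Qh0.
apply: eq_esum => k _; rewrite -ge0_muleDr; last 2 first.
- by apply: integral_ge0 => u _; exact: Qh0.
- by apply: integral_ge0 => u _; exact: Qh0.
congr (_ * _); rewrite -ge0_integralD//; last 4 first.
- by move=> u _; exact: Qh0.
- exact: mQh.
- by move=> u _; exact: Qh0.
- exact: mQh.
by apply: eq_integral => u _; rewrite -EFinD mulrDr.
Qed.

Lemma le_mixture h1 h2 : measurable_fun setT h1 -> (forall u, 0 <= h1 u)%R ->
  measurable_fun setT h2 -> (forall u, h1 u <= h2 u)%R ->
  mixture h1 <= mixture h2.
Proof.
move=> m1 h10 m2 h12; apply: le_esum => k _.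
apply: lee_wpmul2l; first by rewrite lee_fin.
apply: ge0_le_integral => //.
- by move=> u _; exact: Qh0.
- exact: mQh.
- exact: mQh.
- by move=> u _; rewrite lee_fin ler_wpM2l.
Qed.

(** Integrate the tangent inequality [s * t <= eta t + c] at [t = K * h]. The
    functional only has mass at most [K]; since [c] is nonnegative, the term
    [c] contributes no more than [K * c], and it cancels against the value
    [s * y = eta y + c] of the tangent at the point of contact. *)
Lemma mixture_jensen (eta : R -> R) (K y : R) h : convex_phi_function eta ->
  (0 <= K)%R -> mixture (cst 1%R) <= K%:E ->
  measurable_fun setT h -> (forall u, 0 <= h u)%R ->
  (0 <= y)%R -> y%:E <= mixture h ->
  (K * eta y)%:E <= mixture (fun u => eta `|K * h u|%R).
Proof.
move=> heta K0 mass mh h0 y0 yh.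
have [s [c [s0 c0 sy st]]] := cphi_tangent heta y0.
have mKh : measurable_fun setT (fun u => eta `|K * h u|%R).
  by apply: measurable_cphi_norm => //; exact: measurable_funM.
have eta0 u : (0 <= eta `|K * h u|)%R by exact: cphi_ge0.
rewrite -(@leeD2rE _ (K * c)%:E)// -EFinD -mulrDr -sy.
apply: (@le_trans _ _ (mixture (fun u => (s * K) * h u)%R)).
  rewrite mixtureZ ?mulr_ge0// mulrCA mulrA EFinM.
  by apply: lee_wpmul2l => //; rewrite lee_fin mulr_ge0.
apply: (@le_trans _ _
    (mixture ((fun u => eta `|K * h u|) \+ (fun u => c * cst 1 u))%R)).
  apply: le_mixture.
  - exact: measurable_funM.
  - by move=> u; rewrite !mulr_ge0.
  - by apply: measurable_funD => //; exact: measurable_funM.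
  - move=> u /=; rewrite mulr1 -mulrA.
    rewrite -[X in (s * X)%R](ger0_norm (mulr_ge0 K0 (h0 u))); exact: st.
rewrite mixtureD//; last 2 first.
- exact: measurable_funM.
- by move=> u; rewrite mulr_ge0.
by rewrite leeD2l// mixtureZ// mulrC EFinM lee_wpmul2l// lee_fin.
Qed.

End Mixture.
(** * Discrete moments *)

Section DiscreteMoments.
Context {R : realType}.
Implicit Types g : R -> R.
Local Open Scope ereal_scope.

Lemma esum_le_dmoment0 g u :
  \esum_(k in [set: int]) `|g (u - k%:~R)%R|%:E <= dmoment 0 g.
Proof.
apply: ereal_sup_ubound; exists u => //.
by apply: eq_esum => k _; rewrite powRr0 mulr1.
Qed.

Lemma le_dmoment0 g u : `|g u|%:E <= dmoment 0 g.
Proof.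
apply: le_trans (esum_le_dmoment0 g u).
rewrite (esumID [set 0%R])//.
by rewrite setTI esum_set1 ?lee_fin// subr0 leeDl// esum_ge0.
Qed.

Lemma dmoment0_ge0 g : 0 <= dmoment 0 g.
Proof. by apply: le_trans (le_dmoment0 g 0); rewrite lee_fin. Qed.

Lemma esum_near_int (u e M : R) : (0 <= M)%R -> (e <= 1 / 2)%R ->
  \esum_(k in [set: int]) (if `|u - k%:~R| < e then M else 0)%R%:E <= M%:E.
Proof.
move=> M0 e2.
have F0 k : 0 <= (if `|u - k%:~R| < e then M else 0)%R%:E.
  by rewrite lee_fin; case: ifP.
have [[k0 hk0]|nok] := pselect (exists k : int, (`|u - k%:~R| < e)%R); last first.
  rewrite esum1 ?lee_fin// => k _; case: ifPn => // hk.
  by case: nok; exists k.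
rewrite (esumID [set k0])// setTI esum_set1// hk0 esum1 ?adde0// => k [_ /= kk0].
case: ifPn => // hk; case: kk0.
have : ((k - k0)%:~R < 1 :> R)%R /\ ((k0 - k)%:~R < 1 :> R)%R.
  by move: hk hk0; rewrite !ltr_norml !intrB => /andP[? ?] /andP[? ?]; split; lra.
by rewrite !ltrz1 => -[? ?]; lia.
Qed.

(** Near the origin [g] is bounded and at most one integer translate of [u]
    falls there; at distance at least [e] from it, [|g|] is dominated by
    [e `^ (- r)] times the summand of the moment of order [r]. *)
Lemma dmoment0_lty g (r : R) : bounded_near g (nbhs (0%R : R)) -> (0 < r)%R ->
  dmoment r g < +oo -> dmoment 0 g < +oo.
Proof.
move=> /ex_bound[M /nbhs_ballP[e0 /= e00 gM]] r0 gr.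
have M0 : (0 <= M)%R.
  by apply: le_trans (gM 0%R (ballxx _ e00)); exact: normr_ge0.
pose e : R := Num.min e0 (1 / 2)%R.
have ep : (0 < e)%R by rewrite lt_min e00/=; lra.
have er : (0 < e `^ r)%R by rewrite powR_gt0.
have [D gD] : exists D, dmoment r g = D%:E.
  exists (fine (dmoment r g)); rewrite fineK// ge0_fin_numE//.
  apply: le_trans (ereal_sup_ubound _); last by exists 0%R.
  by apply: esum_ge0 => k _; rewrite lee_fin mulr_ge0// powR_ge0.
apply: (@le_lt_trans _ _ (M%:E + ((e `^ r)^-1 * D)%:E)); last first.
  by rewrite -EFinD ltry.
apply: ge_ereal_sup => _ [u _ <-].
have bnd k : (`|g (u - k%:~R)| * `|u - k%:~R| `^ 0)%:E <=
    (if `|u - k%:~R| < e then M else 0)%R%:E +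
    (e `^ r)^-1%:E * (`|g (u - k%:~R)| * `|u - k%:~R| `^ r)%:E.
  rewrite powRr0 mulr1 -EFinM -EFinD lee_fin; case: ifPn => [ue|].
    rewrite -[leLHS]addr0 lerD ?mulr_ge0 ?invr_ge0 ?powR_ge0//.
    by apply: gM; rewrite -ball_normE/= sub0r normrN (lt_le_trans ue)// ge_min lexx.
  rewrite -leNgt add0r => eu; rewrite ler_pdivlMl// mulrC ler_wpM2l//.
  by rewrite ge0_ler_powR// ?nnegrE ?(ltW ep)// ltW.
apply: le_trans (le_esum (fun k _ => bnd k)) _.
rewrite esumD; last 2 first.
- by move=> k _; rewrite lee_fin; case: ifP.
- by move=> k _; rewrite -EFinM lee_fin !mulr_ge0// ?invr_ge0 powR_ge0.
apply: leeD; first by apply: esum_near_int => //; rewrite ge_min lexx orbT.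
rewrite esum_intZl ?invr_ge0 ?powR_ge0//.
rewrite EFinM lee_wpmul2l ?lee_fin ?invr_ge0 ?powR_ge0// -gD.
by apply: ereal_sup_ubound; exists u.
Qed.

(** With [cmoment0_ge1], this makes the denominator of the constant of the
    modular inequality positive. *)
Lemma dmoment0_ge1 g : (forall u, cvg_sumZ (fun k => g (u - k%:~R)%R)) ->
  (forall u, sumZ (fun k => g (u - k%:~R)%R) = 1%R) -> 1 <= dmoment 0 g.
Proof.
move=> cg sg.
have [->|g0] := eqVneq (dmoment 0 g) +oo; first exact: leey.
have := esum_le_dmoment0 g 0; set E := esum _ _ => Eg.
have Eoo : E < +oo by apply: le_lt_trans Eg _; rewrite ltey.
have [_] := normed_cvg_sumZ Eoo.
by rewrite sg normr1 => /le_trans; apply.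
Qed.

End DiscreteMoments.
(** * Durrmeyer sampling operators *)

Section LebesgueKernels.
Context {R : realType}.
Implicit Types g : R -> R.
Local Open Scope ereal_scope.

Lemma in_L1_measurable g : in_L1 g -> lebesgue_measurable g.
Proof. by case/integrableP => mg _; exact/measurable_EFinP. Qed.

Lemma cmoment0E g :
  cmoment 0 g = \int[leb]_(t in [set: lebesgueR R]) `|g t|%:E.
Proof. by apply: eq_integral => t _; rewrite powRr0 mul1r. Qed.

Lemma Lnorm1_cmoment0 g : 'N[leb]_1[EFin \o g] = cmoment 0 g.
Proof. by rewrite Lnorm1 cmoment0E; apply: eq_integral. Qed.

Lemma cmoment0_ge0 g : 0 <= cmoment 0 g.
Proof. by rewrite cmoment0E; apply: integral_ge0 => t _; rewrite lee_fin. Qed.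

Lemma cmoment0_lty g : in_L1 g -> cmoment 0 g < +oo.
Proof. by rewrite cmoment0E => /integrableP[_]. Qed.

Lemma cmoment0_ge1 g : in_L1 g ->
  (\int[leb]_(u in [set: lebesgueR R]) g u = 1)%R -> 1 <= cmoment 0 g.
Proof.
move=> gL g1; rewrite cmoment0E -[1]/(1%R%:E) -(normr1 R) -g1 EFin_normr_Rintegral//.
by apply: le_abse_integral => //; case/integrableP: gL.
Qed.

Lemma lebesgue_measurable_affine g (a b : R) : (0 < a)%R ->
  lebesgue_measurable g -> lebesgue_measurable (fun x => g (a * x - b)%R).
Proof.
by move=> a0 mg; exact: (measurableT_comp mg (measurable_affine (- b) a0)).
Qed.

Lemma measurable_norm_affine g (a b : R) : (0 < a)%R -> lebesgue_measurable g ->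
  measurable_fun [set: lebesgueR R]
    (fun x : lebesgueR R => `|g (a * (x : R) - b)|%R).
Proof.
move=> a0 mg; have mga := lebesgue_measurable_affine b a0 mg.
exact: (measurableT_comp (@normr_measurable R setT) mga).
Qed.

Lemma integral_norm_affine g (a b : R) : (0 < a)%R -> lebesgue_measurable g ->
  \int[leb]_(x in [set: lebesgueR R]) `|g (a * (x : R) - b)%R|%:E =
  a^-1%:E * cmoment 0 g.
Proof.
move=> a0 mg; rewrite cmoment0E.
rewrite -(ge0_integral_affine (- b) a0 (g := fun t => `|g t|%:E))//.
by apply/measurable_EFinP; exact: measurableT_comp.
Qed.

Section Durrmeyer.
Variables (phi psi : R -> R) (w : R).
Hypothesis mphi : lebesgue_measurable phi.
Hypothesis mpsi : lebesgue_measurable psi.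
Hypothesis w0 : (0 < w)%R.

Definition sample (x : R) (k : int) : R := `|phi (w * x - k%:~R)|%R.

Definition window (k : int) (u : lebesgueR R) : R :=
  (w * `|psi (w * (u : R) - k%:~R)|)%R.

Let sample_ge0 x k : (0 <= sample x k)%R. Proof. exact: normr_ge0. Qed.

Let window_ge0 k u : (0 <= window k u)%R.
Proof. by rewrite mulr_ge0// ltW. Qed.

Lemma measurable_window k : measurable_fun setT (window k).
Proof.
exact: (measurable_funM (measurable_cst w) (measurable_norm_affine _ w0 mpsi)).
Qed.

Lemma integral_window k : \int[leb]_u (window k u)%:E = cmoment 0 psi.
Proof.
under eq_integral do rewrite EFinM.
rewrite ge0_integralZl.
- rewrite (integral_norm_affine _ w0 mpsi) muleA -EFinM divff ?gt_eqF//.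
  by rewrite mul1e.
- exact: measurableT.
- exact/measurable_EFinP/(measurable_norm_affine _ w0 mpsi).
- by move=> u _; rewrite lee_fin.
- by rewrite lee_fin ltW.
Qed.

Lemma esum_window u :
  \esum_(k in [set: int]) (window k u)%:E <= w%:E * dmoment 0 psi.
Proof.
under eq_esum do rewrite EFinM.
rewrite esum_intZl; [|by move=> k; rewrite lee_fin|exact: ltW].
by apply: lee_wpmul2l; [rewrite lee_fin ltW|exact: esum_le_dmoment0].
Qed.

Lemma esum_sample x : \esum_(k in [set: int]) (sample x k)%:E <= dmoment 0 phi.
Proof. exact: esum_le_dmoment0. Qed.

Lemma integral_sample k :
  \int[leb]_(x in [set: lebesgueR R]) (sample x k)%:E =
  w^-1%:E * cmoment 0 phi.
Proof. exact: (integral_norm_affine _ w0 mphi). Qed.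

Lemma mixture_mass x (M N : R) : dmoment 0 phi = M%:E -> cmoment 0 psi = N%:E ->
  mixture leb (sample x) window (cst 1%R) <= (M * N)%:E.
Proof.
move=> hM hN; rewrite /mixture.
under eq_esum do under eq_integral do rewrite mulr1.
under eq_esum do rewrite integral_window hN muleC.
have N0 : (0 <= N)%R by rewrite -lee_fin -hN cmoment0_ge0.
rewrite esum_intZl//; last by move=> k; rewrite lee_fin.
by rewrite mulrC EFinM lee_wpmul2l ?lee_fin// -hM esum_sample.
Qed.

Section Growth.
Variables (eta f : R -> R).
Hypothesis heta : convex_phi_function eta.
Hypothesis mf : lebesgue_measurable f.

(** Pointwise, [|f| <= 1 / l + eta(l |f|) / (l * eta 1)], the two summands
    covering the cases [l |f| <= 1] and [1 < l |f|]. The first is integrated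
    against the L^1 norm of the window and the second against its sup norm,
    neither of which depends on [k]. *)
Lemma window_integral_bound : cmoment 0 psi < +oo -> dmoment 0 psi < +oo ->
  (exists2 l : R, (0 < l)%R & modular eta (fun x => l * f x)%R < +oo) ->
  exists C : R, forall k, \int[leb]_u (window k u * `|f u|)%:E <= C%:E.
Proof.
move=> psi1 psioo [l l0 Ioo].
have [N hN] : exists N, cmoment 0 psi = N%:E.
  by exists (fine (cmoment 0 psi)); rewrite fineK// ge0_fin_numE// cmoment0_ge0.
have [D hD] : exists D, dmoment 0 psi = D%:E.
  by exists (fine (dmoment 0 psi)); rewrite fineK// ge0_fin_numE// dmoment0_ge0.
have eta1 : (0 < eta 1)%R by exact: cphi_gt0.
have e0 u : (0 <= eta `|l * f u|)%R by exact: cphi_ge0.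
have [I hI] : exists I, modular eta (fun x => l * f x)%R = I%:E.
  exists (fine (modular eta (fun x => l * f x)%R)); rewrite fineK// ge0_fin_numE//.
  by apply: integral_ge0 => u _; rewrite lee_fin.
have D0 : (0 <= D)%R by rewrite -lee_fin -hD dmoment0_ge0.
have li : (0 <= l^-1)%R by rewrite invr_ge0 ltW.
pose A : R := (w * D * (l * eta 1)^-1)%R.
have A0 : (0 <= A)%R.
  by rewrite /A mulr_ge0 ?invr_ge0 ?mulr_ge0// ltW.
have me : measurable_fun [set: lebesgueR R] (fun u => eta `|l * f u|%R).
  apply: (measurable_cphi_norm heta).
  exact: (measurable_funM (measurable_cst l) mf).
have mnf : measurable_fun [set: lebesgueR R] (fun u => `|f u|%R).
  exact: (measurableT_comp (@normr_measurable R setT) mf).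
have mw k : measurable_fun [set: lebesgueR R] (window k) := measurable_window k.
exists (l^-1 * N + A * I)%R => k.
apply: (@le_trans _ _ (\int[leb]_(u in [set: lebesgueR R])
    (l^-1%:E * (window k u)%:E + A%:E * (eta `|l * f u|)%:E))).
  apply: ge0_le_integral.
  - exact: measurableT.
  - by move=> u _; rewrite lee_fin mulr_ge0.
  - by apply/measurable_EFinP; exact: (measurable_funM (mw k) mnf).
  - by apply: emeasurable_funD; apply: measurable_funeM; exact/measurable_EFinP.
  move=> u _; rewrite -!EFinM -EFinD lee_fin.
  have [fu|fu] := leP (`|l * f u|%R) 1%R.
    rewrite -[leLHS]addr0 lerD ?(mulr_ge0 A0)//.
    rewrite mulrC ler_wpM2r// -[leRHS]mulr1 ler_pdivlMl//.
    by rewrite -[X in (X * _)%R](gtr0_norm l0) -normrM.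
  rewrite -[leLHS]add0r lerD ?(mulr_ge0 li (window_ge0 _ _))//.
  have wu : (window k u <= w * D)%R.
    by rewrite /window ler_wpM2l ?(ltW w0)// -lee_fin -hD le_dmoment0.
  rewrite /A -[leRHS]mulrA; apply: (ler_pM (window_ge0 _ _) (normr_ge0 _) wu).
  have := cphi_ge_linear heta (ltW fu).
  rewrite ler_pdivlMl ?mulr_gt0// normrM (gtr0_norm l0).
  by rewrite mulrA [X in (X * _ <= _)%R]mulrC.
rewrite ge0_integralD; last 5 first.
- exact: measurableT.
- by move=> u _; rewrite mule_ge0// lee_fin.
- by apply: measurable_funeM; exact/measurable_EFinP.
- by move=> u _; rewrite mule_ge0// lee_fin.
- by apply: measurable_funeM; exact/measurable_EFinP.
rewrite ge0_integralZl; last 4 first.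
- exact: measurableT.
- exact/measurable_EFinP.
- by move=> u _; rewrite lee_fin.
- by rewrite lee_fin.
rewrite ge0_integralZl; last 4 first.
- exact: measurableT.
- exact/measurable_EFinP.
- by move=> u _; rewrite lee_fin.
- by rewrite lee_fin.
rewrite integral_window hN -/(modular eta (fun x => l * f x)%R) hI.
by rewrite -!EFinM -EFinD.
Qed.

Variables M N D L : R.
Hypothesis hM : dmoment 0 phi = M%:E.
Hypothesis hN : cmoment 0 psi = N%:E.
Hypothesis hD : dmoment 0 psi = D%:E.
Hypothesis hL : cmoment 0 phi = L%:E.
Hypothesis forl :
  exists2 l : R, (0 < l)%R & modular eta (fun x => l * f x)%R < +oo.

Let mw k : measurable_fun [set: lebesgueR R] (window k) :=
  measurable_window k.

Let mnf : measurable_fun [set: lebesgueR R] (fun u => `|f u|%R).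
Proof. exact: (measurableT_comp (@normr_measurable R setT) mf). Qed.

Let window_integral :
  exists C : R, forall k, \int[leb]_u (window k u * `|f u|)%:E <= C%:E.
Proof. by apply: window_integral_bound => //; rewrite ?hN ?hD ltry. Qed.

Let wf_norm k u : (window k u * `|f u|)%:E =
  w%:E * `|(psi (w * (u : R) - k%:~R) * f u)%R|%:E.
Proof. by rewrite -EFinM /window normrM mulrA. Qed.

Let mpsif k : measurable_fun [set: lebesgueR R]
  (fun u : lebesgueR R => (psi (w * (u : R) - k%:~R) * f u)%R).
Proof. exact: (measurable_funM (lebesgue_measurable_affine _ w0 mpsi) mf). Qed.

Let integral_wf k : \int[leb]_u (window k u * `|f u|)%:E =
  w%:E * \int[leb]_(u in [set: lebesgueR R])
    `|(psi (w * (u : R) - k%:~R) * f u)%R|%:E.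
Proof.
under eq_integral do rewrite wf_norm.
rewrite ge0_integralZl.
- by [].
- exact: measurableT.
- apply/measurable_EFinP.
  exact: (measurableT_comp (@normr_measurable R setT) (mpsif k)).
- by move=> u _; rewrite lee_fin.
- by rewrite lee_fin ltW.
Qed.

Lemma durrmeyer_integrable k : in_L1 (fun u => psi (w * u - k%:~R) * f u)%R.
Proof.
apply/integrableP; split; first exact/measurable_EFinP/mpsif.
have [C hC] := window_integral.
rewrite -(@lte_pmul2l _ w%:E) ?lte_fin// gt0_muley ?lte_fin//.
by rewrite -integral_wf (le_lt_trans (hC k))// ltry.
Qed.

Lemma le_durrmeyer_term x k : `|durrmeyer_term phi psi w f x k|%R%:E <=
  (sample x k)%:E * \int[leb]_u (window k u * `|f u|)%:E.
Proof.
rewrite /durrmeyer_term normrM EFinM; apply: lee_wpmul2l; first by rewrite lee_fin.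
rewrite normrM (gtr0_norm w0) EFinM integral_wf.
apply: lee_wpmul2l; first by rewrite lee_fin ltW.
rewrite EFin_normr_Rintegral; [|exact: measurableT|exact: durrmeyer_integrable].
apply: le_abse_integral; first exact: measurableT.
exact/measurable_EFinP/mpsif.
Qed.

(** Both claims come from the absolute convergence of the series, whose terms
    are dominated by those of the mixture. *)
Lemma durrmeyer_cvg x : cvg_sumZ (durrmeyer_term phi psi w f x) /\
  `|durrmeyer phi psi w f x|%R%:E <=
  mixture leb (sample x) window (fun u => `|f u|%R).
Proof.
have le_mix : \esum_(k in [set: int]) `|durrmeyer_term phi psi w f x k|%R%:E <=
    mixture leb (sample x) window (fun u => `|f u|%R).
  by apply: le_esum => k _; exact: le_durrmeyer_term.
have [C hC] := window_integral.
have C0 : (0 <= C)%R.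
  rewrite -lee_fin; apply: le_trans (hC 0%R); apply: integral_ge0 => u _.
  by rewrite lee_fin mulr_ge0.
have mixoo : mixture leb (sample x) window (fun u => `|f u|%R) <= (C * M)%:E.
  apply: (@le_trans _ _ (\esum_(k in [set: int]) (C%:E * (sample x k)%:E))).
    by apply: le_esum => k _; rewrite muleC; apply: lee_wpmul2r; rewrite ?lee_fin.
  rewrite esum_intZl//; last by move=> k; rewrite lee_fin.
  by rewrite EFinM -hM; apply: lee_wpmul2l; rewrite ?lee_fin// esum_sample.
have [cS lS] := normed_cvg_sumZ (le_lt_trans (le_trans le_mix mixoo) (ltry _)).
by split => //; exact: le_trans lS le_mix.
Qed.

Lemma measurable_durrmeyer : lebesgue_measurable (durrmeyer phi psi w f).
Proof.
apply: (measurable_sumZ (T := lebesgueR R)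
  (f := fun k x => durrmeyer_term phi psi w f x k)).
  move=> k; have mphik := lebesgue_measurable_affine k%:~R w0 mphi.
  exact: (measurable_funM mphik (measurable_cst _)).
by move=> x; exact: (durrmeyer_cvg x).1.
Qed.

(** Tonelli's theorem is used twice: to integrate the samples in [x], which
    leaves [||phi||_1 / w] in front of each window integral [c k], and then to
    sum the windows under the integral in [u]. *)
Lemma modular_durrmeyer (l : R) : (0 <= l)%R ->
  (M * N)%:E * modular eta (fun x => l * durrmeyer phi psi w f x)%R <=
  (D * L)%:E * modular eta (fun x => l * M * N * f x)%R.
Proof.
move=> l0.
have M0 : (0 <= M)%R by rewrite -lee_fin -hM dmoment0_ge0.
have N0 : (0 <= N)%R by rewrite -lee_fin -hN cmoment0_ge0.
have L0 : (0 <= L)%R by rewrite -lee_fin -hL cmoment0_ge0.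
pose H u := eta `|l * M * N * f u|%R.
have H0 u : (0 <= H u)%R by exact: (cphi_ge0 heta (normr_ge0 _)).
have mH : measurable_fun [set: lebesgueR R] H.
  apply: (measurable_cphi_norm heta).
  exact: (measurable_funM (measurable_cst _) mf).
pose c k := \int[leb]_u (window k u * H u)%:E.
have c0 k : 0 <= c k.
  by apply: integral_ge0 => u _; rewrite lee_fin mulr_ge0.
have mwH k : measurable_fun [set: lebesgueR R] (fun u => (window k u * H u)%:E).
  exact/measurable_EFinP/(measurable_funM (mw k) mH).
have msample k : measurable_fun [set: lebesgueR R]
    (fun x : lebesgueR R => (sample x k)%:E).
  exact/measurable_EFinP/(measurable_norm_affine _ w0 mphi).
have jensen x : (M * N * eta `|l * durrmeyer phi psi w f x|%R)%:E <=
    \esum_(k in [set: int]) (c k * (sample x k)%:E).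
  have mlf : measurable_fun [set: lebesgueR R] (fun u => l * `|f u|)%R.
    exact: (measurable_funM (measurable_cst l) mnf).
  have lf0 u : (0 <= l * `|f u|)%R by rewrite mulr_ge0.
  have yS : `|l * durrmeyer phi psi w f x|%R%:E <=
      mixture leb (sample x) window (fun u => l * `|f u|)%R.
    rewrite (mixtureZ leb (sample_ge0 x) window_ge0 mw l0 mnf); last first.
      by move=> u; exact: normr_ge0.
    rewrite normrM (ger0_norm l0) EFinM.
    by apply: lee_wpmul2l; [rewrite lee_fin|exact: (durrmeyer_cvg x).2].
  have := mixture_jensen (sample_ge0 x) window_ge0 mw heta (mulr_ge0 M0 N0)
    (mixture_mass x hM hN) mlf lf0 (normr_ge0 _) yS.
  move=> /le_trans; apply; rewrite le_eqVlt; apply/orP; left; apply/eqP.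
  apply: eq_esum => k _; rewrite muleC; congr (_ * _).
  apply: eq_integral => u _; congr (_ * eta _)%:E.
  by rewrite !normrM normr_id; ring.
rewrite /modular -ge0_integralZl; last 4 first.
- exact: measurableT.
- apply/measurable_EFinP/(measurable_cphi_norm heta).
  exact: (measurable_funM (measurable_cst _) measurable_durrmeyer).
- by move=> x _; rewrite lee_fin cphi_ge0.
- by rewrite lee_fin mulr_ge0.
apply: (@le_trans _ _ (\int[leb]_(x in [set: lebesgueR R])
    \esum_(k in [set: int]) (c k * (sample x k)%:E))).
  apply: ge0_le_integral.
  - exact: measurableT.
  - by move=> x _; rewrite -EFinM lee_fin !mulr_ge0// cphi_ge0.
  - apply: measurable_funeM; apply/measurable_EFinP/(measurable_cphi_norm heta).
    exact: (measurable_funM (measurable_cst _) measurable_durrmeyer).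
  - apply: measurable_esum_int => [k|k x]; first exact: measurable_funeM.
    by rewrite mule_ge0// lee_fin.
  - by move=> x _; rewrite -EFinM; exact: jensen.
rewrite integral_esum_int; last 2 first.
- by move=> k; exact: measurable_funeM.
- by move=> k x; rewrite mule_ge0// lee_fin.
have -> : \esum_(k in [set: int])
    \int[leb]_(x in [set: lebesgueR R]) (c k * (sample x k)%:E) =
    \esum_(k in [set: int]) ((w^-1 * L)%:E * c k).
  apply: eq_esum => k _; rewrite ge0_integralZl; last 4 first.
  - exact: measurableT.
  - exact: msample.
  - by move=> x _; rewrite lee_fin.
  - exact: c0.
  by rewrite integral_sample hL -EFinM muleC.
have wL : (0 <= w^-1 * L)%R by rewrite mulr_ge0// invr_ge0 ltW.
rewrite esum_intZl//.
have -> : (D * L)%:E = (w^-1 * L)%:E * (w * D)%:E.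
  by rewrite -EFinM; congr EFin; field; rewrite gt_eqF.
rewrite -muleA; apply: lee_wpmul2l; first by rewrite lee_fin.
rewrite /c -integral_esum_int; last 2 first.
- exact: mwH.
- by move=> k u; rewrite lee_fin mulr_ge0.
have D0 : (0 <= D)%R by rewrite -lee_fin -hD dmoment0_ge0.
have wD : 0 <= (w * D)%:E by rewrite lee_fin mulr_ge0// ltW.
rewrite -ge0_integralZl; last 4 first.
- exact: measurableT.
- exact/measurable_EFinP.
- by move=> u _; rewrite lee_fin; exact: H0.
- exact: wD.
apply: ge0_le_integral.
- exact: measurableT.
- by move=> u _; apply: esum_ge0 => k _; rewrite lee_fin mulr_ge0.
- by apply: measurable_esum_int => // k u; rewrite lee_fin mulr_ge0.
- by apply: measurable_funeM; exact/measurable_EFinP.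
move=> u _.
have -> : \esum_(k in [set: int]) (window k u * H u)%:E =
    (H u)%:E * \esum_(k in [set: int]) (window k u)%:E.
  rewrite -esum_intZl//; last by move=> k; rewrite lee_fin.
  by apply: eq_esum => k _; rewrite -EFinM mulrC.
rewrite muleC; apply: lee_wpmul2r; first by rewrite lee_fin.
by rewrite EFinM -hD; exact: esum_window.
Qed.

End Growth.
End Durrmeyer.
End LebesgueKernels.
Theorem theorem4p2 (R : realType) (phi psi : R -> R)
    (hker : kernel_pair phi psi) (hpsi : (dmoment 0 psi < +oo)%E)
    (eta : R -> R) (heta : convex_phi_function eta)
    (f : R -> R) (hf : in_orlicz eta f) :
  (exists lambda : R,
    [/\ 0 < lambda,
        (modular eta (fun x =>
           (lambda * fine (dmoment 0 phi) * fine (cmoment 0 psi) * f x)%R)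
         < +oo)%E
      & forall w : R, 0 < w ->
        (modular eta (fun x => (lambda * durrmeyer phi psi w f x)%R)
         <= (dmoment 0 psi * 'N[leb]_1[EFin \o phi]) /
              (dmoment 0 phi * cmoment 0 psi) *
            modular eta (fun x =>
              (lambda * fine (dmoment 0 phi) * fine (cmoment 0 psi)
               * f x)%R))%E]) /\
  (forall w : R, 0 < w ->
     durrmeyer_defined phi psi w f /\
     in_orlicz eta (durrmeyer phi psi w f)).
Proof.
case: hker => phiL psiL phi0 cphi sphi psi1 [r r0 rphi].
case: hf => mf [l l0 Il].
have mphi := in_L1_measurable phiL; have mpsi := in_L1_measurable psiL.
have fin_of (x : \bar R) : (0 <= x)%E -> (x < +oo)%E -> x = (fine x)%:E.
  by move=> x0 xoo; rewrite fineK// ge0_fin_numE.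
have hM := fin_of _ (dmoment0_ge0 phi) (dmoment0_lty phi0 r0 rphi).
have hN := fin_of _ (cmoment0_ge0 psi) (cmoment0_lty psiL).
have hD := fin_of _ (dmoment0_ge0 psi) hpsi.
have hL := fin_of _ (cmoment0_ge0 phi) (cmoment0_lty phiL).
have := dmoment0_ge1 cphi sphi; have := cmoment0_ge1 psiL psi1.
rewrite Lnorm1_cmoment0 hM hN hD hL !lee_fin /=.
set M := fine (dmoment 0 phi) in hM *; set N := fine (cmoment 0 psi) in hN *.
set D := fine (dmoment 0 psi) in hD *; set L := fine (cmoment 0 phi) in hL *.
move=> N1 M1; have M0 := lt_le_trans ltr01 M1; have N0 := lt_le_trans ltr01 N1.
have MN0 : 0 < M * N by rewrite mulr_gt0.
(* then [la * M * N = l], for which the modular of [l * f] is finite *)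
pose la := l / (M * N).
have la0 : 0 < la by rewrite divr_gt0.
have laE : la * M * N = l by rewrite /la; field; rewrite !gt_eqF.
have forl : exists2 l : R,
    0 < l & (modular eta (fun x => l * f x)%R < +oo)%E by exists l.
have bound w : 0 < w ->
    (modular eta (fun x => la * durrmeyer phi psi w f x)%R <=
     (D%:E * L%:E) / (M%:E * N%:E) *
     modular eta (fun x => la * M * N * f x)%R)%E.
  move=> w0.
  have := modular_durrmeyer mphi mpsi w0 heta mf hM hN hD hL forl (ltW la0).
  rewrite -!EFinM inver gt_eqF// -[in X in _ -> X]EFinM => h.
  rewrite -(@lee_pmul2l _ (M * N)%:E)// ?lte_fin// (le_trans h)// muleA -EFinM.
  by rewrite (mulrCA (M * N)) divff ?gt_eqF// mulr1.
split.
  exists la; split; [exact: la0|by rewrite laE|exact: bound].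
move=> w w0; split; first split.
- by move=> k; exact: (durrmeyer_integrable mpsi w0 heta mf hN hD forl k).
- by move=> x; exact: (durrmeyer_cvg mpsi w0 heta mf hM hN hD forl x).1.
split; first exact: (measurable_durrmeyer mphi mpsi w0 heta mf hM hN hD forl).
exists la => //; apply: le_lt_trans (bound w w0) _.
rewrite laE (fin_of _ _ Il); last first.
  by apply: integral_ge0 => x _; rewrite lee_fin cphi_ge0.
by rewrite -!EFinM inver gt_eqF// -!EFinM ltry.
Qed.
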